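(* Let $m$ be a positive integer, $q=2^m$, and $F=\mathbb{F}_q$. Let $b\in F$ and let $n$ be a rational number such that $b^n$ is an element of $F$. Suppose that $b^{4n}+1\neq 0$ and that the two arguments of $K$ below are nonzero. Then $$K\left(\frac{(b^{n+1}+b^2)(b^{n+1}+b^n+b^2+1)^3}{b^{4n}+1}\right)=K\left(\frac{(b^{n+1}+b^2)^3(b^{n+1}+b^n+b^2+1)}{b^{4n}+1}\right).$$
   Context: $F=\mathbb{F}_q$ is the finite field with $q=2^m$ elements, $F^*=F\setminus\{0\}$, and $\mathrm{Tr}$ is the absolute trace function of $F$ over $\mathbb{F}_2$. For $a\in F^*$ the Kloosterman sum is $K(a)=\sum_{x\in F^*}(-1)^{\mathrm{Tr}(ax+1/x)}$. Rational powers: for $n=r/s$ in lowest terms with $s>0$, $b^n$ denotes a fixed element $d\in F$ with $d^s=b^r$ (with $b\neq 0$ if $r<0$, and $b^0=1$); $b^{n+1}=b\cdot b^n$ and $b^{4n}=(b^n)^4$. *)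

(* Defs.v *)
From mathcomp Require Import all_boot all_order all_algebra all_fingroup all_solvable all_field.

Set Implicit Arguments.
Unset Strict Implicit.
Unset Printing Implicit Defensive.

Import GRing.Theory.
Local Open Scope ring_scope.

(* The trace of F over its prime field 'F_2, as an element of F; the            *)
(* definitions below are meant for fields with #|F| = 2 ^ m, for which          *)
(* logn 2 #|F| = m.                                                             *)
Definition absTr (F : finFieldType) (x : F) : F :=
  \sum_(i < logn 2 #|F|) x ^+ (2 ^ i).

Lemma absTr_galTrace (F : finFieldType) (pcharF2 : 2%N \in [pchar F]) (x : F) :
  absTr x = galTrace 1%AS {: pPrimeCharType pcharF2}%AS x.
Proof.
set L := pPrimeCharType pcharF2.
have [alpha defG Dalpha] := finField_galois_generator (sub1v {:L}%AS).
have ordA : #[alpha]%g = logn 2 #|F|.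
  rewrite orderE -(eqP defG) -galois_dim ?finField_galois ?sub1v //.
  by rewrite dimv1 divn1 pprimeChar_dimf.
have Dpow i (y : L) : (alpha ^+ i)%g y = y ^+ (2 ^ i).
  elim: i => [|i IHi]; first by rewrite expg0 gal_id.
  rewrite expgSr galM ?memvf // IHi Dalpha ?memvf // dimv1 expn1 card_Fp //.
  by rewrite expnSr exprM.
rewrite /galTrace (eqP defG) /absTr -ordA.
pose h (i : 'I_#[alpha]%g) := (alpha ^+ i)%g.
have injh : injective h.
  move=> i j /eqP; rewrite eq_expg_mod_order !modn_small // => /eqP.
  exact: val_inj.
have -> : <[alpha]>%g = h @: 'I_#[alpha]%g.
  apply/setP=> s; apply/cycleP/imsetP => [[i ->] | [i _ ->]]; last by exists i.
  exists (Ordinal (ltn_pmod i (order_gt0 alpha))) => //.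
  by rewrite /h /= expg_mod_order.
rewrite big_imset /=; last by move=> i j _ _; apply: injh.
by apply: eq_bigr => i _; rewrite Dpow.
Qed.

Lemma absTr_bool (F : finFieldType) (m : nat) (x : F) :
  #|F| = (2 ^ m)%N -> (absTr x == 0) || (absTr x == 1).
Proof.
move=> cardF; have pcharF2 := card_finPcharP cardF isT.
have cardE : #|F| = (2 ^ logn 2 #|F|)%N by rewrite cardF pfactorK.
rewrite -[_ == 1]subr_eq0 -mulf_eq0 mulrBr mulr1 subr_eq0 -expr2 /absTr.
have -> (E : F) : E ^+ 2 = pFrobenius_aut pcharF2 E by [].
rewrite rmorph_sum /= -subr_eq0 -sumrB.
under eq_bigr => i _ do rewrite pFrobenius_autE -exprM -expnSr.
rewrite -(big_mkord xpredT (fun i => x ^+ (2 ^ i.+1) - x ^+ (2 ^ i))).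
by rewrite telescope_sumr // -cardE expf_card expn0 expr1 subrr.
Qed.

(* (-1) ^ Tr(x), legitimate because Tr(x) is 0 or 1 by absTr_bool. *)
Definition trSign (F : finFieldType) (x : F) : int := (-1) ^+ (absTr x != 0).

Definition Kloosterman (F : finFieldType) (a : F) : int :=
  \sum_(x : F | x != 0) trSign (a * x + x^-1).

(* "d is a value of b ^ n". A rational power is only determined up to the       *)
(* choice of a root, hence a relation. numq n / denq n is n in lowest terms     *)
(* with denq n > 0; for n < 0 the clause b != 0 is needed because MathComp sets *)
(* 0^-1 = 0.                                                                    *)
Definition is_ratpow (F : fieldType) (b : F) (n : rat) (d : F) : Prop :=
  (n < 0 -> b != 0) /\ d ^ denq n = b ^ numq n.

Lemma is_ratpow0 (F : fieldType) (b d : F) : is_ratpow b 0 d <-> d = 1.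
Proof.
by rewrite /is_ratpow (numq_int 0) (denq_int 0) expr0z expr1z; split=> [[]|].
Qed.

(* Main.v *)
Require Import Defs.
From mathcomp Require Import all_boot all_order all_algebra all_fingroup all_solvable all_field.
From mathcomp Require Import ring.
Import GRing.Theory.
Local Open Scope ring_scope.

(** Write d for the value of b ^ n. In characteristic 2 the numerators are
    products of powers of X = b (d + b) and Y = (b + 1) (d + b + 1), and
    X + Y = d + 1, so that d ^ 4 + 1 = (X + Y) ^ 4. With k = X / Y the identity
    becomes
        K (k / (1 + k) ^ 4) = K (k ^ 3 / (1 + k) ^ 4).

    Behind this is a 3-isogeny. The sum K (a) determines the number of points
    of the elliptic curve y ^ 2 + x y = x ^ 3 + a, and the curves of the two
    parameters above are linked by an isogeny of degree 3; isogenous curves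
    over a finite field have equally many points. The proof makes this
    elementary, with the map that the isogeny induces on suitably scaled
    x-coordinates,
        phi (w) = w (1 + k w) ^ 2 / (1 + w) ^ 2.
    It carries the exponent of one sum to the exponent of the other, up to an
    Artin-Schreier term z ^ 2 + z, which has trace zero (absTr_isogeny). So it
    suffices that, after adding the constant k / (1 + k) to both exponents, phi
    restricts to a bijection between the nonzero elements where the one exponent
    has trace 1 and those where the other does.

    The constant is chosen so that this trace decides how phi behaves: the
    fibre of phi through w is given by a cubic, and once w is divided out the
    remaining quadratic has Artin-Schreier invariant equal, in trace, to the
    shifted exponent at w. If that trace is 1 the quadratic has no root, hence
    phi is injective there (isogeny_inj). Surjectivity (isogeny_surj) needs a
    root of the cubic for a given value of phi, and follows from the classical
    trace criterion for x ^ 3 + P x + Q in characteristic 2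
    (cubic_root_of_absTr), itself proved by counting: an injective self-map of
    a finite set is onto. *)

(** * The trace in characteristic two *)

Section TraceCharTwo.
Set Implicit Arguments.
Unset Strict Implicit.
Variables (m : nat) (F : finFieldType).
Hypothesis cardF : #|F| = (2 ^ m)%N.
Implicit Types a p t u v w x y : F.

Lemma two_eq0 : 2%:R = 0 :> F.
Proof. exact: pcharf0 (card_finPcharP cardF isT). Qed.

Lemma add_self x : x + x = 0.
Proof. by ring: two_eq0. Qed.

(** The values of 3 and 4, like that of 2, serve as rewriting rules for the
    coefficients when ring and field normalise in characteristic 2. *)
Lemma three_eq1 : 3%:R = 1 :> F.
Proof. by rewrite [LHS](natrD _ 2 1) two_eq0 add0r. Qed.

Lemma four_eq0 : 4%:R = 0 :> F.
Proof. by rewrite (natrM _ 2 2) two_eq0 mul0r. Qed.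

Lemma sqrD_char2 x y : (x + y) ^+ 2 = x ^+ 2 + y ^+ 2.
Proof. by ring: two_eq0. Qed.

Lemma add_eq0_char2 x y : (x + y == 0) = (x == y).
Proof. by rewrite -(inj_eq (addIr y)) -addrA add_self addr0 add0r. Qed.

Lemma absTrD x y : absTr (x + y) = absTr x + absTr y.
Proof.
have pchar2 := card_finPcharP cardF isT.
rewrite /absTr -big_split; apply: eq_bigr => i _ /=.
by rewrite exprDn_pchar ?pnatX ?pnatE // pchar2.
Qed.

Lemma absTr0 : absTr (0 : F) = 0.
Proof. by rewrite -[in LHS](add_self 0) absTrD add_self. Qed.

Lemma absTr_sqr x : absTr (x ^+ 2) = absTr x.
Proof.
have pchar2 := card_finPcharP cardF isT.
(* The trace lies in the prime field, so it equals its own square. *)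
transitivity (absTr x ^+ 2); last first.
  by case/orP: (absTr_bool x cardF) => /eqP ->; rewrite ?expr0n ?expr1n.
rewrite -[absTr x ^+ 2](pFrobenius_autE pchar2) /absTr rmorph_sum.
apply: eq_bigr => i _ /=.
by rewrite !pFrobenius_autE exprAC.
Qed.

Lemma absTr_artin_schreier0 t : absTr (t ^+ 2 + t) = 0.
Proof. by rewrite absTrD absTr_sqr add_self. Qed.

Lemma absTr_artin_schreier y x t : x + y = t ^+ 2 + t -> absTr x = absTr y.
Proof.
move=> xyE; apply/eqP.
by rewrite -add_eq0_char2 -absTrD xyE absTr_artin_schreier0.
Qed.

(** Since x = 1 + (1 + x), the double pole and the simple pole of this fraction
    combine into z ^ 2 + z, which the trace does not see. *)
Lemma artin_schreier_frac x :
  1 + x != 0 -> x / (1 + x) ^+ 2 = ((1 + x)^-1) ^+ 2 + (1 + x)^-1.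
Proof.
move=> x1; transitivity ((1 + (1 + x)) / (1 + x) ^+ 2); last by field.
by rewrite addrA add_self add0r.
Qed.

(** * Sums of trace signs *)

Lemma trSignD x y : trSign (x + y) = trSign x * trSign y.
Proof.
rewrite /trSign absTrD.
case/orP: (absTr_bool x cardF) => /eqP ->;
  case/orP: (absTr_bool y cardF) => /eqP ->;
  by rewrite ?addr0 ?add0r ?add_self ?eqxx ?oner_eq0.
Qed.

(** Each sign is 1 - 2 [trace is 1], so a sum of signs only depends on how many
    terms have trace 1. *)
Lemma eq_sum_trSign (f g : F -> F) :
  #|[set x | (x != 0) && (absTr (f x) != 0)]|
    = #|[set x | (x != 0) && (absTr (g x) != 0)]| ->
  \sum_(x | x != 0) trSign (f x) = \sum_(x | x != 0) trSign (g x).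
Proof.
have sumE (h : F -> F) : \sum_(x | x != 0) trSign (h x)
    = #|[pred x : F | x != 0]|%:R
      - 2%:R * #|[set x | (x != 0) && (absTr (h x) != 0)]|%:R.
  rewrite -!sum1_card !natr_sum mulr_sumr.
  under [in X in _ - X]eq_bigl => x do rewrite inE.
  rewrite [X in _ - X]big_mkcondr -sumrB; apply: eq_bigr => x _.
  by rewrite /trSign; case: (absTr (h x) != 0).
by rewrite !sumE => ->.
Qed.

Lemma Kloosterman_scale a p :
  p != 0 -> Kloosterman a = \sum_(x | x != 0) trSign (a * (p * x) + (p * x)^-1).
Proof.
move=> p_neq0; rewrite /Kloosterman (reindex_inj (mulfI p_neq0)).
by apply: eq_bigl => x; rewrite mulf_eq0 negb_or p_neq0.
Qed.

(** * A trace criterion for roots of cubics *)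

(** A second cube root of y ^ 3 would give a primitive cube root of unity z,
    and 1 = z ^ 2 + z has trace zero. *)
Lemma cube_inj : absTr (1 : F) != 0 -> injective (fun x => x ^+ 3).
Proof.
move=> tr1 x y /= xyE; have two0 := two_eq0.
have [// | x_neq_y] := eqVneq x y.
have [y0 | y_neq0] := eqVneq y 0.
  move/eqP: xyE; rewrite y0 expr0n expf_eq0 /= => /eqP x0.
  by rewrite x0 y0 eqxx in x_neq_y.
have : (x ^+ 2 + x * y + y ^+ 2) * (x + y) = 0.
  by transitivity (x ^+ 3 + y ^+ 3); [ring: two0 | rewrite xyE add_self].
move/eqP; rewrite mulf_eq0 (add_eq0_char2 x) (negPf x_neq_y) orbF => /eqP quad.
case/eqP: tr1; rewrite -absTr0; apply: (@absTr_artin_schreier _ _ (x / y)).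
transitivity ((x ^+ 2 + x * y + y ^+ 2) / y ^+ 2
              + ((x / y) ^+ 2 + x / y)); last by rewrite quad mul0r add0r.
by field: two0.
Qed.

(** The trace hypothesis reads Tr (P ^ 3 / Q ^ 2) <> Tr 1 for P = p ^ 2; since
    every element is a square and squaring preserves the trace, the square root
    p of P is the more convenient parameter.

    For p <> 0 put r = p / w: the equation becomes f (w) = p ^ 3 / Q for
    f (w) = w ^ 3 / (1 + w) ^ 2. The set S of nonzero w with
    Tr (w + 1) = 1 contains p ^ 3 / Q, is mapped by f to itself because
    f (w) + w is of Artin-Schreier form, and f is injective on it: a second
    solution would make (w + 1) ^ 2 of Artin-Schreier form. As S is finite, f
    maps it onto itself. *)
Lemma cubic_root_of_absTr p Q :
  Q != 0 -> absTr (p ^+ 3 / Q + 1) != 0 ->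
  exists r, r ^+ 3 + p ^+ 2 * r + Q = 0.
Proof.
move=> Q_neq0 tr_pQ; have two0 := two_eq0.
have [p0 | p_neq0] := eqVneq p 0.
  have tr1 : absTr (1 : F) != 0.
    by move: tr_pQ; rewrite p0 expr0n mul0r add0r.
  have [cbrt _ cbrtK] := injF_bij (cube_inj tr1).
  exists (cbrt Q); rewrite cbrtK p0 expr0n mul0r addr0; exact: add_self.
pose S := [set w : F | (w != 0) && (absTr (w + 1) != 0)].
pose f w := w ^+ 3 / (1 + w) ^+ 2.
have S_neq1 w : w \in S -> 1 + w != 0.
  rewrite inE => /andP[_]; apply: contraNneq => w1.
  by rewrite addrC w1 absTr0.
have fS : f @: S = S.
  apply/eqP; rewrite eqEcard; apply/andP; split.
    apply/subsetP=> _ /imsetP[w wS ->]; have w1 := S_neq1 w wS.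
    move: wS; rewrite !inE => /andP[w0 trw].
    rewrite mulf_neq0 ?invr_eq0 ?expf_neq0 //=.
    rewrite (@absTr_artin_schreier (w + 1) _ (1 + w)^-1) //.
    transitivity (w / (1 + w) ^+ 2); last exact: artin_schreier_frac.
    transitivity ((w ^+ 3 + w * (1 + w) ^+ 2) / (1 + w) ^+ 2).
      by rewrite addrACA add_self addr0 /f; field.
    by congr (_ / _); ring: two0.
  rewrite card_in_imset // => w t wS tS fE; apply/eqP/negPn/negP => w_neq_t.
  have w1 := S_neq1 w wS; have t1 := S_neq1 t tS.
  move: wS tS; rewrite !inE => /andP[w0 trw] /andP[t0 _].
  have prod0 : (w ^+ 2 + w * t + t ^+ 2 + w ^+ 2 * t ^+ 2) * (w + t) = 0.
    transitivity ((1 + w) ^+ 2 * (1 + t) ^+ 2 * (f w + f t)).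
      by rewrite /f; field: two0; rewrite ?w1 ?t1.
    by rewrite fE add_self mulr0.
  move/eqP: prod0; rewrite mulf_eq0 (add_eq0_char2 w) (negPf w_neq_t) orbF.
  move=> /eqP quad; case/eqP: trw; rewrite -absTr_sqr.
  have -> : (w + 1) ^+ 2 = (w / t) ^+ 2 + w / t.
    transitivity ((w ^+ 2 + w * t + t ^+ 2 + w ^+ 2 * t ^+ 2) / t ^+ 2
                  + ((w / t) ^+ 2 + w / t)); last by rewrite quad mul0r add0r.
    by field: two0.
  exact: absTr_artin_schreier0.
have : p ^+ 3 / Q \in S by rewrite inE tr_pQ mulf_neq0 ?invr_eq0 ?expf_neq0.
rewrite -fS => /imsetP[w wS fE]; exists (p / w).
have w1 := S_neq1 w wS; move: wS; rewrite inE => /andP[w0 _].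
have -> : Q = p ^+ 3 / f w by rewrite -fE; field; rewrite p_neq0 Q_neq0.
by rewrite /f; field: two0; rewrite ?w0 ?w1.
Qed.

(** * The isogeny of degree three *)

Section ThreeIsogeny.
Variable k : F.
Hypotheses (k_neq0 : k != 0) (k1_neq0 : 1 + k != 0).

(** The map on x-coordinates, scaled so that the nontrivial points of the
    kernel lie over w = 1. *)
Definition isogeny w := w * (1 + k * w) ^+ 2 / (1 + w) ^+ 2.

(** The exponent of the sum for k ^ 3 / (1 + k) ^ 4 after the substitution
    x = (1 + k) ^ 2 / k * w and the addition of k / (1 + k). This constant
    makes the exponent vanish at the pole w = 1 and at the zero w = 1 / k of
    the isogeny. *)
Definition source_exp w := k * (1 + w) * (1 + k * w) / (w * (1 + k) ^+ 2).

(** The exponent of the sum for k / (1 + k) ^ 4 after the same substitution and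
    the same shift. *)
Definition target_exp v := (v + k / v) / (1 + k) ^+ 2 + k / (1 + k).

Lemma source_expE w :
  w != 0 ->
  source_exp w = (k ^+ 2 * w + k / w) / (1 + k) ^+ 2 + k / (1 + k).
Proof.
move=> w0; have two0 := two_eq0.
by rewrite /source_exp; field: two0; rewrite ?w0 ?k1_neq0.
Qed.

Lemma Kloosterman_source :
  Kloosterman (k ^+ 3 / (1 + k) ^+ 4)
    = (\sum_(w | w != 0) trSign (source_exp w)) * trSign (k / (1 + k)).
Proof.
rewrite mulr_suml (@Kloosterman_scale _ ((1 + k) ^+ 2 / k)); last first.
  by rewrite mulf_neq0 ?invr_eq0 ?expf_neq0.
apply: eq_bigr => w w0; rewrite -trSignD; congr trSign.
rewrite source_expE // -addrA add_self addr0.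
by field; rewrite w0 k_neq0 k1_neq0.
Qed.

Lemma Kloosterman_target :
  Kloosterman (k / (1 + k) ^+ 4)
    = (\sum_(v | v != 0) trSign (target_exp v)) * trSign (k / (1 + k)).
Proof.
rewrite mulr_suml (@Kloosterman_scale _ ((1 + k) ^+ 2 / k)); last first.
  by rewrite mulf_neq0 ?invr_eq0 ?expf_neq0.
apply: eq_bigr => v v0; rewrite -trSignD; congr trSign.
rewrite /target_exp -addrA add_self addr0.
by field; rewrite v0 k_neq0 k1_neq0.
Qed.

(** The isogeny preserves the exponent up to
    w / (1 + w) ^ 2 + k w / (1 + k w) ^ 2: the first fraction comes from the
    pole of the isogeny, the second from its zero, and both are of
    Artin-Schreier form. *)
Lemma absTr_isogeny w :
  w != 0 -> 1 + w != 0 -> 1 + k * w != 0 ->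
  absTr (target_exp (isogeny w)) = absTr (source_exp w).
Proof.
move=> w0 w1 kw1; have two0 := two_eq0.
apply: (@absTr_artin_schreier _ _ ((1 + w)^-1 + (1 + k * w)^-1)).
have isoD : isogeny w + k ^+ 2 * w = (1 + k) ^+ 2 * (w / (1 + w) ^+ 2).
  transitivity ((w * (1 + k * w) ^+ 2 + k ^+ 2 * w * (1 + w) ^+ 2)
                / (1 + w) ^+ 2); first by rewrite /isogeny; field.
  by rewrite mulrA; congr (_ / _); ring: two0.
have isoV : k / isogeny w + k / w = (1 + k) ^+ 2 * (k * w / (1 + k * w) ^+ 2).
  transitivity (k * ((1 + w) ^+ 2 + (1 + k * w) ^+ 2)
                / (w * (1 + k * w) ^+ 2)).
    by rewrite /isogeny; field; rewrite ?w0 ?w1 ?kw1.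
  have -> : (1 + w) ^+ 2 + (1 + k * w) ^+ 2 = (1 + k) ^+ 2 * w ^+ 2.
    by ring: two0.
  by field; rewrite ?w0 ?kw1.
rewrite source_expE // addrACA add_self addr0 -mulrDl addrACA isoD isoV.
rewrite -mulrDr mulrC mulKf ?expf_neq0 //.
by rewrite !artin_schreier_frac // sqrD_char2 addrACA.
Qed.

Lemma source_exp_absTr1 w :
  absTr (source_exp w) != 0 -> 1 + w != 0 /\ 1 + k * w != 0.
Proof.
move=> trw; split; apply: contraNneq trw => w1;
  by rewrite /source_exp w1 ?mulr0 ?mul0r absTr0.
Qed.

(** Dividing the equation isogeny u = isogeny w by w + u leaves a quadratic in
    u. A root u of it exhibits source_exp w ^ 2 in the form y ^ 2 + y, against
    the trace hypothesis. *)
Lemma isogeny_inj w u :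
  w != 0 -> absTr (source_exp w) != 0 -> 1 + u != 0 ->
  isogeny w = isogeny u -> w = u.
Proof.
move=> w0 trw u1 isoE; have two0 := two_eq0; have three1 := three_eq1.
have four0 := four_eq0; have [w1 kw1] := source_exp_absTr1 trw.
apply/eqP/negPn/negP => w_neq_u.
pose G := (1 + k * w) ^+ 2 + (1 + k) ^+ 2 * (w * u)
          + k ^+ 2 * (1 + w) ^+ 2 * u ^+ 2.
have : G * (w + u) = 0.
  transitivity (w * (1 + k * w) ^+ 2 * (1 + u) ^+ 2
                + u * (1 + k * u) ^+ 2 * (1 + w) ^+ 2).
    by rewrite /G; ring: two0 three1 four0.
  transitivity ((1 + w) ^+ 2 * (1 + u) ^+ 2 * (isogeny w + isogeny u)).
    by rewrite /isogeny; field; rewrite ?w1 ?u1.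
  by rewrite isoE add_self mulr0.
move/eqP; rewrite mulf_eq0 (add_eq0_char2 w) (negPf w_neq_u) orbF => /eqP G0.
case/eqP: trw; rewrite -absTr_sqr.
(* This is the substitution that brings A u ^ 2 + B u + C to Artin-Schreier
   form, y = (A / B) u, for the coefficients of G. *)
pose y := k ^+ 2 * (1 + w) ^+ 2 * u / ((1 + k) ^+ 2 * w).
have -> : source_exp w ^+ 2 = y ^+ 2 + y.
  apply/eqP; rewrite -add_eq0_char2; apply/eqP.
  transitivity (G * (k ^+ 2 * (1 + w) ^+ 2 / ((1 + k) ^+ 4 * w ^+ 2))).
    by rewrite /source_exp /y /G; field; rewrite ?w0 ?k1_neq0.
  by rewrite G0 mul0r.
exact: absTr_artin_schreier0.
Qed.

(** In terms of s = 1 / w, isogeny w = v is the cubic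
    v s (1 + s) ^ 2 = (k + s) ^ 2, and s = r + 1 / v removes its quadratic
    term. The trace criterion for the depressed cubic in r is the hypothesis on
    v up to an Artin-Schreier term. *)
Lemma isogeny_surj v :
  v != 0 -> absTr (target_exp v) != 0 ->
  exists w, [/\ w != 0, 1 + w != 0, 1 + k * w != 0 & isogeny w = v].
Proof.
move=> v0 trv; have two0 := two_eq0; have three1 := three_eq1.
have four0 := four_eq0.
have [||r rE] := @cubic_root_of_absTr (1 + v^-1) ((1 + k) ^+ 2 / v).
- by rewrite mulf_neq0 ?invr_eq0 ?expf_neq0.
- rewrite (@absTr_artin_schreier (target_exp v) _ ((1 + v^-1) / (1 + k))) //.
  (* In terms of c = 1 + k all denominators are monomials, which keeps the
     coefficients that field meets small. *)
  rewrite /target_exp; have c0 := k1_neq0; set c := 1 + k in c0 *.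
  have -> : k = 1 + c by rewrite /c addrA add_self add0r.
  by field: two0 three1 four0; rewrite ?v0 ?c0.
pose s := r + v^-1.
have sE : v * s * (1 + s) ^+ 2 = (k + s) ^+ 2.
  apply/eqP; rewrite -add_eq0_char2; apply/eqP.
  transitivity (v * (r ^+ 3 + (1 + v^-1) ^+ 2 * r + (1 + k) ^+ 2 / v)).
    have -> : r = s + v^-1 by rewrite /s -addrA add_self addr0.
    by field: two0 three1 four0.
  by rewrite rE mulr0.
have s0 : s != 0.
  apply: contraNneq k_neq0 => s0; move/eqP: sE.
  by rewrite s0 mulr0 mul0r addr0 eq_sym expf_eq0.
have s1 : 1 + s != 0.
  apply: contraNneq k1_neq0 => /eqP; rewrite add_eq0_char2 => /eqP s1.
  by move/eqP: sE; rewrite -s1 add_self expr0n mulr0 eq_sym expf_eq0 addrC.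
have sk : k + s != 0.
  have: (k + s) ^+ 2 != 0 by rewrite -sE !mulf_neq0 ?expf_neq0.
  by rewrite expf_eq0.
have w1E : 1 + s^-1 = (1 + s) / s by field.
have kw1E : 1 + k * s^-1 = (k + s) / s by field.
exists s^-1; rewrite /isogeny w1E kw1E; split; rewrite ?mulf_neq0 ?invr_eq0 //.
transitivity ((k + s) ^+ 2 / (s * (1 + s) ^+ 2)).
  by field; rewrite ?s0 ?s1.
by rewrite -sE; field; rewrite ?s0 ?s1.
Qed.

Lemma Kloosterman_three_isogeny :
  Kloosterman (k ^+ 3 / (1 + k) ^+ 4) = Kloosterman (k / (1 + k) ^+ 4).
Proof.
rewrite Kloosterman_source Kloosterman_target; congr (_ * _).
apply: eq_sum_trSign; set S := [set w | _]; set T := [set v | _].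
have iso_inj : {in S &, injective isogeny}.
  move=> w u; rewrite !inE => /andP[w0 trw] /andP[_ /source_exp_absTr1[u1 _]].
  exact: isogeny_inj.
rewrite -(card_in_imset iso_inj); congr #|pred_of_set _|.
apply/setP=> v; apply/imsetP/idP=> [[w + ->] | ]; rewrite inE => /andP[].
  move=> w0 trw; have [w1 kw1] := source_exp_absTr1 trw.
  by rewrite inE absTr_isogeny // trw !mulf_neq0 ?invr_eq0 ?expf_neq0.
move=> v0 trv; have [w [w0 w1 kw1 isoE]] := isogeny_surj v0 trv.
by exists w; rewrite // inE w0 -absTr_isogeny // isoE.
Qed.

End ThreeIsogeny.

End TraceCharTwo.

(** * The identity *)

Theorem theorem6 (m : nat) (m_gt0 : (0 < m)%N)
    (F : finFieldType) (cardF : #|F| = (2 ^ m)%N)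
    (b : F) (n : rat) (bn : F) (bnP : is_ratpow b n bn)
    (den_neq0 : bn ^+ 4 + 1 != 0)
    (argL_neq0 :
       (b * bn + b ^+ 2) * (b * bn + bn + b ^+ 2 + 1) ^+ 3 / (bn ^+ 4 + 1) != 0)
    (argR_neq0 :
       (b * bn + b ^+ 2) ^+ 3 * (b * bn + bn + b ^+ 2 + 1) / (bn ^+ 4 + 1) != 0) :
  Kloosterman ((b * bn + b ^+ 2) * (b * bn + bn + b ^+ 2 + 1) ^+ 3 / (bn ^+ 4 + 1))
  = Kloosterman ((b * bn + b ^+ 2) ^+ 3 * (b * bn + bn + b ^+ 2 + 1) / (bn ^+ 4 + 1)).
Proof.
have two0 := two_eq0 cardF.
set X := b * bn + b ^+ 2 in argL_neq0 *.
set Y := b * bn + bn + b ^+ 2 + 1 in argL_neq0 *.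
have XYE : X + Y = bn + 1 by rewrite /X /Y; ring: two0.
have denE : bn ^+ 4 + 1 = (X + Y) ^+ 4.
  by rewrite XYE (exprM (bn + 1) 2 2) !(sqrD_char2 cardF) !expr1n -exprM.
have XY0 : X + Y != 0 by move: den_neq0; rewrite denE expf_eq0.
rewrite denE.
have X0 : X != 0 by apply: contraNneq argL_neq0 => ->; rewrite !mul0r.
have Y0 : Y != 0.
  by apply: contraNneq argL_neq0 => ->; rewrite expr0n mulr0 mul0r.
have k0 : X / Y != 0 by rewrite mulf_neq0 ?invr_eq0.
have k1E : 1 + X / Y = (X + Y) / Y by field.
have k1 : 1 + X / Y != 0 by rewrite k1E mulf_neq0 ?invr_eq0.
have := Kloosterman_three_isogeny cardF k0 k1; rewrite k1E.
have -> : (X / Y) ^+ 3 / ((X + Y) / Y) ^+ 4 = X ^+ 3 * Y / (X + Y) ^+ 4.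
  by field; rewrite ?Y0 ?XY0.
have -> : X / Y / ((X + Y) / Y) ^+ 4 = X * Y ^+ 3 / (X + Y) ^+ 4.
  by field; rewrite ?Y0 ?XY0.
by [].
Qed.
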